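(* Let $\Omega$ be a set, and $s,t\in\mathcal{J}(\Omega)$, the monoid of all injective functions from $\Omega$ to $\Omega$. Then the following are equivalent. (1) $s\sim_p t$. (2) $s\sim_p^1 t$. (3) $s\sim_n t$. (4) $s=ptp^{-1}$ for some $p\in\mathcal{S}(\Omega)$, the group of all permutations of $\Omega$. (5) $E(s)\cong E(t)$. (6) There is a bijection between the set of cycles of $s$ and the set of cycles of $t$ that sends each cycle to one of the same type.
   Context: For a monoid $S$ and $s,t\in S$: $s\sim_p^1 t$ means there exist $p,r\in S$ with $s=pr$ and $t=rp$; $\sim_p$ is the transitive closure of $\sim_p^1$; $s\sim_n t$ means there exist $p,r\in S$ with $sp=pt$, $rs=tr$, $rsp=t$, and $ptr=s$. For $s:\Omega\to\Omega$, $E(s)$ is the simple directed graph (loops allowed) with vertex set $\Omega$ and an edge $(\alpha,\beta)$ exactly when $s(\alpha)=\beta$; $\cong$ denotes isomorphism of directed graphs. For $s\in\mathcal{J}(\Omega)$, a cycle (connected component) of $s$ is a nonempty subset $\Sigma\subseteq\Omega$ such that (i) for all $\alpha\in\Omega$, $s(\alpha)\in\Sigma$ if and only if $\alpha\in\Sigma$, and (ii) $\Sigma$ has no proper nonempty subset satisfying (i). (Every cycle is countable.) A cycle $\Sigma$ is a forward cycle if it is infinite and there is an element $\alpha\in\Sigma\setminus s(\Omega)$; an infinite cycle that is not forward is an open cycle. Two cycles $\Sigma_1,\Sigma_2$ (of possibly different elements of $\mathcal{J}(\Omega)$) are of the same type if $|\Sigma_1|=|\Sigma_2|$ and, in case $|\Sigma_1|=|\Sigma_2|=\aleph_0$,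 both are forward or both are open. *)

(* Defs.v *)
From HB Require Import structures.
From Stdlib Require Export Relation_Operators.
From mathcomp Require Export all_boot.
From mathcomp Require Export boolp classical_sets functions cardinality.

Set Implicit Arguments.
Unset Strict Implicit.
Unset Printing Implicit Defensive.

Local Open Scope classical_set_scope.
Local Open Scope card_scope.

Section MonoidConjugacy.
Variable S : monoidType.
Implicit Types s t : S.
Local Open Scope group_scope.

Definition pconj1 s t : Prop := exists p r : S, s = p * r /\ t = r * p.

Definition pconj : S -> S -> Prop := clos_trans S pconj1.

Definition nconj s t : Prop :=
  exists p r : S, [/\ s * p = p * t, r * s = t * r, r * s * p = t
                    & p * t * r = s].

End MonoidConjugacy.

(* The library type {inj [set: Omega] >-> Omega} is unsuitable for J(Omega):
   its elements carry a chosen partial inverse, so two of them may differ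
   although the underlying functions are equal. *)
Record injmap (Omega : Type) := InjMap {
  injmap_fun :> Omega -> Omega;
  injmap_inj : injective injmap_fun
}.

Lemma injmap_ext (Omega : Type) (s t : injmap Omega) : s =1 t -> s = t.
Proof.
case: s t => [f fI] [g gI] /= /funext fg; rewrite -{g}fg in gI *.
by rewrite (Prop_irrelevance fI gI).
Qed.

Section InjMapMonoid.
Variable Omega : Type.

HB.instance Definition _ := gen_eqMixin (injmap Omega).
HB.instance Definition _ := gen_choiceMixin (injmap Omega).

Definition injmap_id : injmap Omega := InjMap (@inj_id Omega).

(* Maps act on the left: (s * t) x = s (t x). *)
Definition injmap_comp (s t : injmap Omega) : injmap Omega :=
  InjMap (inj_comp (@injmap_inj _ s) (@injmap_inj _ t)).

Lemma injmap_compA : associative injmap_comp.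
Proof. by move=> s t u; apply: injmap_ext. Qed.

Lemma injmap_comp1s : left_id injmap_id injmap_comp.
Proof. by move=> s; apply: injmap_ext. Qed.

Lemma injmap_comps1 : right_id injmap_id injmap_comp.
Proof. by move=> s; apply: injmap_ext. Qed.

HB.instance Definition _ := isMonoid.Build (injmap Omega)
  injmap_compA injmap_comp1s injmap_comps1.

End InjMapMonoid.

Record permutation (Omega : Type) := Permutation {
  perm_map :> Omega -> Omega;
  perm_inv : Omega -> Omega;
  perm_mapK : cancel perm_map perm_inv;
  perm_invK : cancel perm_inv perm_map
}.

(* At most one edge for each ordered pair of vertices; loops allowed. *)
Record digraph := Digraph {
  vertex : Type;
  edge : vertex -> vertex -> Prop
}.

Definition digraph_iso (G H : digraph) : Prop :=
  exists f : vertex G -> vertex H,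
    bijective f /\ forall x y, edge x y <-> edge (f x) (f y).

Definition fun_digraph (Omega : Type) (s : Omega -> Omega) : digraph :=
  @Digraph Omega (fun x y => s x = y).

Section Cycles.
Variable Omega : Type.
Implicit Types (s t : injmap Omega) (A B : set Omega).

Definition biclosed s A : Prop := forall x : Omega, A (s x) <-> A x.

Definition is_cycle s A : Prop :=
  [/\ A !=set0, biclosed s A
    & ~ exists B, [/\ B `<` A, B !=set0 & biclosed s B]].

Definition forward_cycle s A : Prop :=
  [/\ is_cycle s A, infinite_set A & exists x, A x /\ ~ range s x].

Definition open_cycle s A : Prop :=
  [/\ is_cycle s A, infinite_set A & ~ forward_cycle s A].

Definition same_type s t A B : Prop :=
  A #= B /\
  (A #= [set: nat] -> B #= [set: nat] ->
     (forward_cycle s A /\ forward_cycle t B) \/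
     (open_cycle s A /\ open_cycle t B)).

Definition cycles s : set (set Omega) := [set A | is_cycle s A].

End Cycles.

(* Main.v *)
Require Import Defs.

Set Implicit Arguments.
Unset Strict Implicit.
Unset Printing Implicit Defensive.

Local Open Scope classical_set_scope.
Local Open Scope card_scope.

(** The condition to which the others are compared is the existence of a
    bijection f with f s = t f, which is what an isomorphism from E(s) to E(t)
    amounts to (fun_digraph_isoP).

    Suppose that s = pr and t = rp. Then r s = t r and s p = p t, so r and p
    are injective morphisms between E(s) and E(t), and the Cantor-Bernstein
    bijection built from them is an isomorphism (cantor_bernstein_iso): the set
    on which it uses r, namely the set of all (pr)^n y with y outside the range
    of p, is a union of connected components of s. Since isomorphism is
    transitive, p-conjugacy implies it too.

    In the n-conjugacy equations s p = p t, r s = t r, r s p = t and p t r = s,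
    injectivity lets t and s be cancelled, leaving r p = 1 = p r, so that p is
    a permutation.

    An isomorphism carries cycles to cycles, and forward ones to forward ones.
    Conversely, let a type-preserving bijection of the cycles be given. Pick a
    base point in each cycle, outside the range of the map whenever possible.
    The points of the cycle of a are the solutions x of s^m x = s^n a, for
    natural numbers m and n; sending such an x to the y with t^m y = t^n b,
    where b is the base point of the corresponding cycle, is well defined and
    bijective as soon as a and b return to themselves at the same times and
    have m-fold preimages for the same m (iso_of_matched). Equality of types
    ensures this (same_type_matched): a finite cycle is determined by its
    cardinality, and an infinite one, being countable, by whether its base
    point has a preimage. *)

(** * Isomorphisms of functional digraphs *)

Section Isomorphisms.
Variables U V : Type.
Implicit Types (s : U -> U) (t : V -> V).

Lemma fun_digraph_isoP s t :
  digraph_iso (fun_digraph s) (fun_digraph t) <->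
  exists2 f : U -> V, bijective f & forall x, f (s x) = t (f x).
Proof.
split=> [[f [fB fE]]|[f fB fE]]; exists f => //.
  by move=> x; symmetry; apply/(fE x (s x)).
by split=> // x y /=; rewrite -fE; split=> [->|/(bij_inj fB)].
Qed.

(** The graph of an isomorphism may be given as a relation, which treats
    the two sides symmetrically. *)
Lemma iso_of_rel s t (R : U -> V -> Prop) :
  (forall x, exists y, R x y) -> (forall y, exists x, R x y) ->
  (forall x y y', R x y -> R x y' -> y = y') ->
  (forall x x' y, R x y -> R x' y -> x = x') ->
  (forall x y, R x y -> R (s x) (t y)) ->
  digraph_iso (fun_digraph s) (fun_digraph t).
Proof.
move=> /choice[f fR] /choice[g gR] Rf Ri Rst; apply/fun_digraph_isoP.
exists f => [|x]; last exact: Rf (fR _) (Rst _ _ (fR x)).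
exists g => [x|y]; first exact: Ri (gR _) (fR x).
exact: Rf (fR _) (gR y).
Qed.

Definition from_complement (p : V -> U) (s : U -> U) : set U :=
  [set x | exists n y, ~ range p y /\ x = iter n s y].

(** The bijection is r on from_complement p (p \o r), and the inverse of p
    elsewhere. It is equivariant because a point z belongs to that set if and
    only if p (r z) does. *)
Lemma cantor_bernstein_iso (p : V -> U) (r : U -> V) :
  injective p -> injective r ->
  digraph_iso (fun_digraph (p \o r)) (fun_digraph (r \o p)).
Proof.
move=> pI rI; pose A := from_complement p (p \o r).
have step x : A x -> A (p (r x)).
  by move=> [n [y [py ->]]]; exists n.+1, y.
have unstep x : A (p (r x)) -> A x.
  move=> [[|n] [y [py /= E]]]; first by case: py; exists (r x).
  by exists n, y; split=> //; apply/rI/pI.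
have off x : ~ A x -> range p x.
  by apply: contra_notP => px; exists 0%N, x.
apply: (@iso_of_rel _ _
  (fun x y => (A x /\ y = r x) \/ (~ A x /\ x = p y))).
- move=> x; have [Ax|nAx] := pselect (A x); first by exists (r x); left.
  by have [y _ yx] := off _ nAx; exists y; right.
- move=> y; have [Ay|] := pselect (A (p y)); last by exists (p y); right.
  case: (Ay) => [[|n] [z [pz /= E]]]; first by case: pz; exists y.
  by exists (iter n (p \o r) z); left; split; [exists n, z; split|apply: pI].
- move=> x y y' [[Ax ->]|[nAx E]] [[Ax' ->]|[nAx' E']] //.
  by apply: pI; rewrite -E.
- move=> x x' y [[Ax E]|[nAx E]] [[Ax' E']|[nAx' E']].
  + by apply: rI; rewrite -E.
  + by case: nAx'; rewrite E' E; apply: step.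
  + by case: nAx; rewrite E E'; apply: step.
  + by rewrite E E'.
- move=> x y [[Ax ->]|[nAx E]] /=.
    by left; split=> //; apply: step.
  by right; split=> [/unstep/nAx|]; rewrite ?E.
Qed.

End Isomorphisms.

Lemma digraph_iso_trans G H K :
  digraph_iso G H -> digraph_iso H K -> digraph_iso G K.
Proof.
move=> [f [fB fE]] [g [gB gE]]; exists (g \o f).
by split=> [|x y]; [apply: bij_comp|rewrite fE gE].
Qed.

(** * Conjugacy in the monoid of injective maps *)

Section Conjugacy.
Variable Omega : Type.
Implicit Types s t : injmap Omega.

Lemma iso_of_pconj1 s t :
  pconj1 s t -> digraph_iso (fun_digraph s) (fun_digraph t).
Proof.
by move=> [p [r [-> ->]]]; apply: cantor_bernstein_iso; apply: injmap_inj.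
Qed.

Lemma iso_of_pconj s t :
  pconj s t -> digraph_iso (fun_digraph s) (fun_digraph t).
Proof.
elim=> [{}s {}t /iso_of_pconj1 //|{}s {}t u _ st _ tu].
exact: digraph_iso_trans st tu.
Qed.

Lemma iso_witness s t :
  digraph_iso (fun_digraph s) (fun_digraph t) ->
  exists f g : injmap Omega, (g * f = 1 /\ f * g = 1 /\ f * s = t * f)%g.
Proof.
move=> /fun_digraph_isoP[f [g fK gK] fE].
exists (InjMap (can_inj fK)), (InjMap (can_inj gK)).
by split; [|split]; apply: injmap_ext.
Qed.

Lemma pconj1_of_iso s t :
  digraph_iso (fun_digraph s) (fun_digraph t) -> pconj1 s t.
Proof.
move=> /iso_witness[f [g [gf [fg fs]]]]; exists g, (t * f)%g.
by rewrite -fs mulgA gf mul1g fs -mulgA fg mulg1.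
Qed.

Lemma nconj_of_iso s t :
  digraph_iso (fun_digraph s) (fun_digraph t) -> nconj s t.
Proof.
move=> /iso_witness[f [g [gf [fg fs]]]]; exists g, f.
have sE : s = (g * t * f)%g by rewrite -mulgA -fs mulgA gf mul1g.
split=> //; last by rewrite fs -mulgA fg mulg1.
by rewrite sE -mulgA fg mulg1.
Qed.

(** From r s = t r and r s p = t comes t (r p) = t, and t cancels; then
    s (p r) = p t r = s, and s cancels. *)
Lemma perm_of_nconj s t : nconj s t ->
  exists p : permutation Omega,
    injmap_fun s = perm_map p \o injmap_fun t \o perm_inv p.
Proof.
move=> [p [r [sp rs rsp ptr]]].
have rpK : cancel p r.
  move=> x; apply: (@injmap_inj _ t).
  by rewrite -[in RHS]rsp rs.
have prK : cancel r p.
  move=> x; apply: (@injmap_inj _ s).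
  by rewrite -[in RHS]ptr -sp.
by exists (Permutation rpK prK); rewrite -[in LHS]ptr.
Qed.

Lemma iso_of_perm s t (p : permutation Omega) :
  injmap_fun s = perm_map p \o injmap_fun t \o perm_inv p ->
  digraph_iso (fun_digraph s) (fun_digraph t).
Proof.
case: p => p q pK qK /= ->; apply/fun_digraph_isoP.
by exists q => [|x]; [exists p|rewrite /= pK].
Qed.

End Conjugacy.

(** * Isomorphisms transport cycles *)

Section Transport.
Variables (Omega : Type) (s t : injmap Omega) (f g : Omega -> Omega).
Hypotheses (fK : cancel f g) (gK : cancel g f).
Hypothesis fE : forall x, f (s x) = t (f x).

Lemma image_can A : g @` (f @` A) = A.
Proof.
by rewrite image_comp -[RHS]image_id; apply: eq_imagel => x _ /=; apply: fK.
Qed.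

Lemma image_canE (A : set Omega) x : (f @` A) x <-> A (g x).
Proof.
split=> [[y Ay <-]|Agx]; first by rewrite fK.
by exists (g x); rewrite ?gK.
Qed.

Lemma inv_equivariant x : g (t x) = s (g x).
Proof. by rewrite -{1}[x]gK -fE fK. Qed.

Lemma biclosed_image A : biclosed s A -> biclosed t (f @` A).
Proof. by move=> As x; rewrite !image_canE inv_equivariant As. Qed.

End Transport.

Section TransportCycles.
Variable Omega : Type.
Implicit Types (s t : injmap Omega) (f g : Omega -> Omega) (A : set Omega).

Lemma is_cycle_image s t f g A :
  cancel f g -> cancel g f -> (forall x, f (s x) = t (f x)) ->
  is_cycle s A -> is_cycle t (f @` A).
Proof.
move=> fK gK fE [[a Aa] As Amin]; split; first by exists (f a), a.
  exact: biclosed_image As.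
move=> [B [[BfA fAB] [b Bb] Bt]]; apply: Amin; exists (g @` B); split.
- split=> [_ [y /BfA[x Ax <-] <-]|AgB]; first by rewrite fK.
  by apply: fAB => _ [x /AgB[y By <-] <-]; rewrite gK.
- by exists (g b), b.
- exact: (biclosed_image gK fK (inv_equivariant fK gK fE) Bt).
Qed.

Lemma forward_cycle_image s t f g A :
  cancel f g -> cancel g f -> (forall x, f (s x) = t (f x)) ->
  forward_cycle s A -> forward_cycle t (f @` A).
Proof.
move=> fK gK fE [cA iA [a [Aa sa]]]; split.
- exact: is_cycle_image cA.
- move=> fA; apply: iA; rewrite -(image_can fK A); exact: finite_image.
- exists (f a); split; first by exists a.
  move=> [y _ ty]; apply: sa; exists (g y) => //.
  by rewrite -(inv_equivariant fK gK fE) ty fK.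
Qed.

Lemma same_type_image s t f g A :
  cancel f g -> cancel g f -> (forall x, f (s x) = t (f x)) ->
  is_cycle s A -> same_type s t A (f @` A).
Proof.
move=> fK gK fE cA; split=> [|A_nat fA_nat].
  by rewrite card_eq_sym; apply: inj_card_eq => x y _ _; apply: can_inj fK _ _.
have infinite (B : set Omega) : B #= [set: nat] -> infinite_set B.
  by move=> /card_eqPle[_]; rewrite infiniteP.
have [fw|nfw] := pselect (forward_cycle s A); [left|right]; split=> //.
- exact: forward_cycle_image fw.
- by split=> //; apply: infinite.
- split; [exact: is_cycle_image cA|exact: infinite|move=> fw; apply: nfw].
  rewrite -(image_can fK A); apply: forward_cycle_image fw => //.
  exact: inv_equivariant.
Qed.

Lemma cycle_bijection_of_iso s t :
  digraph_iso (fun_digraph s) (fun_digraph t) ->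
  exists F : set Omega -> set Omega,
    set_bij (cycles s) (cycles t) F /\
    forall A, cycles s A -> same_type s t A (F A).
Proof.
move=> /fun_digraph_isoP[f [g fK gK] fE].
have gE := inv_equivariant fK gK fE.
exists (fun A => f @` A); split=> [|A cA]; last exact: same_type_image cA.
split=> [A cA|A B _ _ fAB|B cB].
- exact: is_cycle_image cA.
- by rewrite -(image_can fK A) fAB image_can.
- by exists (g @` B); [apply: is_cycle_image cB|apply: image_can].
Qed.

End TransportCycles.

(** * Cycles as connected components *)

Section Linked.
Variable T : Type.
Implicit Types (s : T -> T) (a x y : T).

Definition linked s a : set T :=
  [set x | exists m n, iter m s x = iter n s a].

Lemma linked_refl s a : linked s a a.
Proof. by exists 0%N, 0%N. Qed.

Lemma linked_sym s a x : linked s a x -> linked s x a.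
Proof. by move=> [m [n E]]; exists n, m. Qed.

Lemma linked_trans s a x y : linked s a x -> linked s x y -> linked s a y.
Proof.
move=> [m [n E]] [p [q E']]; exists (m + p)%N, (q + n)%N.
by rewrite iterD E' -iterD addnC iterD E -iterD.
Qed.

Lemma linked_step s x : linked s x (s x).
Proof. by exists 0%N, 1%N. Qed.

Lemma iter_injective s n : injective s -> injective (iter n s).
Proof. by move=> sI; elim: n => // n IH x y /sI/IH. Qed.

Lemma iter_mul_fixed s a k n : iter k s a = a -> iter (n * k) s a = a.
Proof. by move=> ak; elim: n => // n IH; rewrite mulSn iterD IH. Qed.

Lemma iter_modn s a k n : iter k s a = a -> iter n s a = iter (n %% k) s a.
Proof.
by move=> ak; rewrite {1}(divn_eq n k) addnC iterD iter_mul_fixed.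
Qed.

End Linked.

Section CycleComponents.
Variables (Omega : Type) (s : injmap Omega).
Implicit Types (A B : set Omega).

Lemma biclosed_linked B x y : biclosed s B -> linked s x y -> B x -> B y.
Proof.
move=> sB [m [n E]] Bx.
have iterB z k : B (iter k s z) <-> B z by elim: k => //= k <-; apply: sB.
by apply/(iterB y m); rewrite E; apply/iterB.
Qed.

Lemma linked_biclosed a : biclosed s (linked s a).
Proof.
move=> x; split=> [asx|ax]; last exact: linked_trans ax (linked_step _ _).
exact: linked_trans asx (linked_sym (linked_step _ _)).
Qed.

Lemma is_cycle_linked a : is_cycle s (linked s a).
Proof.
split; [by exists a; apply: linked_refl|exact: linked_biclosed|].
move=> [B [[Ba aB] [b Bb] sB]]; apply: aB => x ax.
apply: (biclosed_linked sB _ Bb); apply: linked_trans ax.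
exact/linked_sym/Ba.
Qed.

Lemma cycle_linkedE A a : is_cycle s A -> A a -> A = linked s a.
Proof.
move=> [_ sA Amin] Aa; apply/seteqP; split; last first.
  by move=> x ax; apply: biclosed_linked Aa.
apply: contrapT => nA; apply: Amin; exists (linked s a); split.
- by split=> // x ax; apply: biclosed_linked Aa.
- by exists a; apply: linked_refl.
- exact: linked_biclosed.
Qed.

(** The two exponents witnessing that a point is linked to a determine it. *)
Lemma countable_linked a : countable (linked s a).
Proof.
have [h hE] : exists h : Omega -> nat * nat, forall x, linked s a x ->
    iter (h x).1 s x = iter (h x).2 s a.
  suff /choice[h] : forall x, exists mn : nat * nat, linked s a x ->
    iter mn.1 s x = iter mn.2 s a by exists h.
  move=> x; have [[m [n E]]|nax] := pselect (linked s a x).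
    by exists (m, n).
  by exists (0, 0)%N.
have hI : {in linked s a &, injective h}.
  move=> x y /set_mem/hE Ex /set_mem/hE Ey hxy.
  apply: (iter_injective (n := (h x).1) (@injmap_inj _ s)).
  by rewrite Ex hxy Ey.
by rewrite -(eq_countable (inj_card_eq hI)); apply: countableP.
Qed.

End CycleComponents.

(** * Gluing along matched base points *)

(** For injective maps these two conditions say that the components of a and b,
    with these base points, are isomorphic. *)
Definition matched (U V : Type) (s : U -> U) (t : V -> V) (a : U) (b : V) :=
  (forall k, iter k s a = a <-> iter k t b = b) /\
  (forall k, (exists x, iter k s x = a) <-> (exists y, iter k t y = b)).

Lemma matched_sym (U V : Type) (s : U -> U) (t : V -> V) a b :
  matched s t a b -> matched t s b a.
Proof. by move=> [per pre]; split=> k; [rewrite per|rewrite pre]. Qed.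

Section Matched.
Variables (U V : Type) (s : U -> U) (t : V -> V).
Hypotheses (sI : injective s) (tI : injective t).

Lemma matched_iter a b m n : matched s t a b ->
  iter m s a = iter n s a -> iter m t b = iter n t b.
Proof.
move=> [per _]; wlog mn : m n / (m <= n)%N.
  by move=> W; have [/W//|/ltnW/W W' /esym/W'/esym] := leqP m n.
rewrite -(subnKC mn) !iterD => /(iter_injective sI)/esym E.
by congr iter; apply/esym/per.
Qed.

Lemma matched_preimage a b m n : matched s t a b ->
  (exists x, iter m s x = iter n s a) -> exists y, iter m t y = iter n t b.
Proof.
move=> [_ pre] [x]; have [mn _|/ltnW nm] := leqP m n.
  by exists (iter (n - m) t b); rewrite -iterD subnKC.
rewrite -(subnKC nm) iterD => /(iter_injective sI) E.
have /pre[y <-] : exists x, iter (m - n) s x = a by exists x.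
by exists y; rewrite iterD.
Qed.

Definition transported (I : Type) (a : I -> U) (b : I -> V) x y :=
  exists i m n, iter m s x = iter n s (a i) /\ iter m t y = iter n t (b i).

Variables (I : Type) (a : I -> U) (b : I -> V).
Hypothesis ab : forall i, matched s t (a i) (b i).

Lemma transported_total :
  (forall x, exists i, linked s (a i) x) ->
  forall x, exists y, transported a b x y.
Proof.
move=> cov x; have [i [m [n E]]] := cov x.
have [|y Ey] := @matched_preimage _ _ m n (ab i); first by exists x.
by exists y, i, m, n.
Qed.

(** Eliminating x from s^m x = s^n a and s^m' x = s^n' a gives
    s^(m'+n) a = s^(m+n') a, and hence the same equation for t and b. *)
Lemma transported_functional :
  (forall i j x, linked s (a i) x -> linked s (a j) x -> i = j) ->
  forall x y y', transported a b x y -> transported a b x y' -> y = y'.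
Proof.
move=> dis x y y' [i [m [n [Ex Ey]]]] [j [m' [n' [Ex' Ey']]]].
have ij : i = j by apply: (dis _ _ x); [exists m, n|exists m', n'].
subst j; have E : iter (m' + n) s (a i) = iter (m + n') s (a i).
  by rewrite iterD -Ex -iterD addnC iterD Ex' -iterD.
apply: (iter_injective (n := (m' + m)%N) tI).
rewrite iterD Ey -iterD (matched_iter (ab i) E).
by rewrite iterD -Ey' -iterD addnC.
Qed.

End Matched.

Lemma transported_sym (U V : Type) (s : U -> U) (t : V -> V) (I : Type)
    (a : I -> U) (b : I -> V) x y :
  transported s t a b x y -> transported t s b a y x.
Proof. by move=> [i [m [n [E E']]]]; exists i, m, n. Qed.

Lemma iso_of_matched (U V : Type) (s : U -> U) (t : V -> V) (I : Type)
    (a : I -> U) (b : I -> V) :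
  injective s -> injective t -> (forall i, matched s t (a i) (b i)) ->
  (forall x, exists i, linked s (a i) x) ->
  (forall i j x, linked s (a i) x -> linked s (a j) x -> i = j) ->
  (forall y, exists i, linked t (b i) y) ->
  (forall i j y, linked t (b i) y -> linked t (b j) y -> i = j) ->
  digraph_iso (fun_digraph s) (fun_digraph t).
Proof.
move=> sI tI ab acov adis bcov bdis.
have ba i : matched t s (b i) (a i) by apply: matched_sym.
apply: (@iso_of_rel _ _ _ _ (transported s t a b)).
- exact: transported_total.
- move=> y; have [x xy] := transported_total tI ba bcov y.
  by exists x; apply: transported_sym.
- exact: transported_functional.
- move=> x x' y xy xy'.
  exact: (transported_functional tI sI ba bdis)
    (transported_sym xy) (transported_sym xy').
- move=> x y [i [m [n [Ex Ey]]]]; exists i, m, n.+1.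
  by rewrite -!iterSr !iterS Ex Ey.
Qed.

(** * Base points of cycles of the same type *)

Section BasePoints.
Variable Omega : Type.
Implicit Types (s t : injmap Omega) (A B : set Omega) (a b : Omega).

(** In a forward cycle the base point has to be the unique point outside the
    range. *)
Definition base_point s A a : Prop :=
  A a /\ forall x, A x -> ~ range s x -> ~ range s a.

Lemma ex_base_point s A : is_cycle s A -> exists a, base_point s A a.
Proof.
move=> [[a Aa] _ _].
have [[x [Ax sx]]|none] := pselect (exists x, A x /\ ~ range s x).
  by exists x.
by exists a; split=> // x Ax sx; case: none; exists x.
Qed.

(** Going backwards m steps from a periodic point a amounts to going forwards
    m (k - 1) steps. *)
Lemma periodic_cycle s A a k : is_cycle s A -> A a -> (0 < k)%N ->
  iter k s a = a -> A = (fun n => iter n s a) @` `I_k.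
Proof.
move=> cA Aa k0 ak; rewrite (cycle_linkedE cA Aa).
apply/seteqP; split=> [x [m [n E]]|_ [n _ <-]]; last by exists 0%N, n.
exists ((n + m * k.-1) %% k)%N; first by rewrite /= ltn_mod.
rewrite -iter_modn //; apply: (iter_injective (n := m) (@injmap_inj _ s)).
rewrite E -iterD addnCA -mulnS prednK // iterD.
by rewrite iter_mul_fixed.
Qed.

Lemma finite_cycle_periodic s A a : is_cycle s A -> A a -> finite_set A ->
  exists2 k, (0 < k)%N & iter k s a = a.
Proof.
move=> cA Aa finA; apply: contrapT => aper.
suff : infinite_set A by [].
have inj m n : (m <= n)%N -> iter m s a = iter n s a -> m = n.
  move=> mn; rewrite -{1}(subnKC mn) iterD.
  move=> /(iter_injective (@injmap_inj _ s)) E; apply/eqP; rewrite eqn_leq mn.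
  by rewrite -subn_eq0 eqn0Ngt; apply/negP => k0; apply: aper; exists (n - m)%N.
have oI : injective (fun n => iter n s a).
  move=> m n /= E; have [/inj->//|/ltnW/inj->//] := leqP m n.
apply/infiniteP; rewrite -(card_le_eql (inj_card_eq (in2W oI))).
apply: subset_card_le => _ [n _ <-]; rewrite (cycle_linkedE cA Aa).
by exists 0%N, n.
Qed.

Lemma finite_cycle_period s A a : is_cycle s A -> A a -> finite_set A ->
  exists k, [/\ (0 < k)%N, A #= `I_k &
    forall j, iter j s a = a <-> (k %| j)%N].
Proof.
move=> cA Aa finA; have [l l0 al] := finite_cycle_periodic cA Aa finA.
have : exists k, (0 < k)%N && `[< iter k s a = a >].
  by exists l; rewrite l0; apply/asboolP.
case/ex_minnP => k /andP[k0 /asboolP ak] kmin.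
have ret j : iter j s a = a <-> (k %| j)%N.
  split=> [aj|/dvdnP[q ->]]; last exact: iter_mul_fixed.
  rewrite /dvdn eqn0Ngt; apply/negP => r0.
  have /kmin : (0 < j %% k)%N && `[< iter (j %% k) s a = a >].
    by rewrite r0; apply/asboolP; rewrite -iter_modn.
  by rewrite leqNgt ltn_mod k0.
exists k; split=> //; rewrite (periodic_cycle cA Aa k0 ak).
apply: inj_card_eq => m n /set_mem/= mk /set_mem/= nk.
wlog mn : m n mk nk / (m <= n)%N.
  by move=> W; have [/W|/ltnW/W W' /esym/W'->//] := leqP m n; first exact.
rewrite -{1}(subnKC mn) iterD => /(iter_injective (@injmap_inj _ s))/esym/ret.
have [/eqP|kle] := posnP (n - m)%N.
  by rewrite subn_eq0 => nm _; apply/eqP; rewrite eqn_leq mn.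
by move=> /(dvdn_leq kle); rewrite leqNgt (leq_ltn_trans (leq_subr _ _) nk).
Qed.

Lemma infinite_cycle_aperiodic s A a k : is_cycle s A -> A a ->
  infinite_set A -> iter k s a = a -> k = 0%N.
Proof.
move=> cA Aa infA ak; have [//|k0] := posnP k; case: infA.
by rewrite (periodic_cycle cA Aa k0 ak); apply: finite_image.
Qed.

Lemma infinite_cycle_card s A : is_cycle s A -> infinite_set A ->
  A #= [set: nat].
Proof.
move=> cA /infiniteP natA; have [[a Aa] _ _] := cA.
rewrite card_eq_le natA andbT (cycle_linkedE cA Aa).
exact: countable_linked.
Qed.

Lemma cycle_preimages s A a : is_cycle s A -> A a ->
  (forall x, A x -> range s x) -> forall k, exists x, iter k s x = a.
Proof.
move=> [_ sA _] Aa sur k.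
suff [x _ <-] : exists2 x, A x & iter k s x = a by exists x.
elim: k => [|k [x Ax <-]]; first by exists a.
have [y _ E] := sur x Ax; exists y; first by apply/sA; rewrite E.
by rewrite iterSr E.
Qed.

(** A finite cycle gives no constraint on preimages; an infinite cycle gives
    none on periods, and all preimages of its base point exist or none does. *)
Lemma same_type_matched s t A B a b :
  is_cycle s A -> is_cycle t B -> same_type s t A B ->
  base_point s A a -> base_point t B b -> matched s t a b.
Proof.
move=> cA cB [AB type] [Aa rooted_a] [Bb rooted_b].
have [finA|infA] := pselect (finite_set A).
  have finB : finite_set B by rewrite -(eq_finite_set AB).
  have [k [k0 Ak perA]] := finite_cycle_period cA Aa finA.
  have [l [l0 Bl perB]] := finite_cycle_period cB Bb finB.
  have kl : k = l.
    apply/card_eq_II; apply: card_eq_trans (card_eq_trans AB Bl).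
    exact: card_esym.
  have back (u : injmap Omega) c m :
      iter k u c = c -> exists x, iter m u x = c.
    move=> ck; exists (iter (m * k.-1) u c).
    by rewrite -iterD -mulnS prednK // iter_mul_fixed.
  split=> j; first by rewrite perA perB kl.
  split=> _; apply: back; first by apply/perB; rewrite kl.
  exact/perA.
have infB : infinite_set B by rewrite -(eq_finite_set AB).
split=> [k|k].
  by split=> [/(infinite_cycle_aperiodic cA Aa infA) ->
             |/(infinite_cycle_aperiodic cB Bb infB) ->].
have [] := type (infinite_cycle_card cA infA) (infinite_cycle_card cB infB).
- move=> [[_ _ [x [Ax sx]]] [_ _ [y [By ty]]]].
  have root (u : injmap Omega) c : ~ range u c ->
      (exists z, iter k u z = c) <-> k = 0%N.
    move=> uc; split=> [[z]|->]; last by exists c.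
    by case: k => // k cE; case: uc; exists (iter k u z).
  by rewrite !root //; [apply: rooted_b By ty|apply: rooted_a Ax sx].
- have onto (u : injmap Omega) C : open_cycle u C -> forall x, C x -> range u x.
    move=> [cC infC nfw] x Cx; apply: contrapT => ux.
    by apply: nfw; split=> //; exists x.
  move=> [/onto sA /onto tB]; split=> _.
    exact: cycle_preimages cB Bb tB k.
  exact: cycle_preimages cA Aa sA k.
Qed.

Lemma iso_of_cycle_bijection s t (F : set Omega -> set Omega) :
  set_bij (cycles s) (cycles t) F ->
  (forall A, cycles s A -> same_type s t A (F A)) ->
  digraph_iso (fun_digraph s) (fun_digraph t).
Proof.
move=> [Ft FI Fsur] Ftype.
pose I := {A | cycles s A}.
have /choice[a aP] (i : I) : exists a, base_point s (sval i) a.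
  exact: ex_base_point (svalP i).
have /choice[b bP] (i : I) : exists b, base_point t (F (sval i)) b.
  exact: ex_base_point (Ft _ (svalP i)).
have aE i : sval i = linked s (a i).
  exact: cycle_linkedE (svalP i) (aP i).1.
have bE i : F (sval i) = linked t (b i).
  exact: cycle_linkedE (Ft _ (svalP i)) (bP i).1.
have sval_eq (i j : I) : sval i = sval j -> i = j.
  by case: i j => A cA [B cB] /= E; apply: eq_exist.
have linked_eq (u : injmap Omega) c d x :
    linked u c x -> linked u d x -> linked u c = linked u d.
  move=> cx dx; apply: cycle_linkedE; first exact: is_cycle_linked.
  exact: linked_trans cx (linked_sym dx).
apply: (@iso_of_matched _ _ _ _ I a b); try exact: injmap_inj.
- move=> i; apply: same_type_matched (aP i) (bP i); first exact: svalP.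
    exact: Ft (svalP i).
  exact: Ftype (svalP i).
- move=> x; exists (exist _ _ (is_cycle_linked s x)).
  by rewrite -aE; apply: linked_refl.
- by move=> i j x ix jx; apply: sval_eq; rewrite !aE; apply: linked_eq ix jx.
- move=> y; have [A cA AE] := Fsur _ (is_cycle_linked t y).
  by exists (exist _ A cA); rewrite -bE /= AE; apply: linked_refl.
- move=> i j y iy jy; apply: sval_eq.
  apply: FI; [exact/mem_set/svalP|exact/mem_set/svalP|].
  by rewrite !bE; apply: linked_eq iy jy.
Qed.

End BasePoints.

Theorem theorem36 (Omega : Type) (s t : injmap Omega) :
  [<-> pconj s t;
       pconj1 s t;
       nconj s t;
       exists p : permutation Omega,
         injmap_fun s = perm_map p \o injmap_fun t \o perm_inv p;
       digraph_iso (fun_digraph s) (fun_digraph t);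
       exists F : set Omega -> set Omega,
         set_bij (cycles s) (cycles t) F /\
         forall A, cycles s A -> same_type s t A (F A)].
Proof.
tfae.
- by move=> /iso_of_pconj/pconj1_of_iso.
- by move=> /iso_of_pconj1/nconj_of_iso.
- exact: perm_of_nconj.
- by move=> [p /iso_of_perm].
- exact: cycle_bijection_of_iso.
- move=> [F [Fbij Ftype]]; apply: t_step; apply: pconj1_of_iso.
  exact: iso_of_cycle_bijection Fbij Ftype.
Qed.
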